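(* Assume the Continuity Assumption, the Consistency Assumption and the Estimator Continuity Assumption below, and let $g^*$ be the optimal fair classifier described below. Let $\tilde g$ be the pseudo-oracle classifier described below. Then $$\limsup_{n\to\infty}\Big(\mathbb{E}_{\mathcal{D}_n}[\mathcal{R}(\tilde g)]-\mathcal{R}(g^* )\Big)\le0.$$
   Context: Let $(X,S,Y)$ be a random tuple in $\mathbb{R}^d\times\{0,1\}\times\{0,1\}$ with joint law $\mathbb{P}$, $\mathbb{P}(S=1)\in(0,1)$, $\mathbb{P}(Y=1)\in(0,1)$. Classifiers are measurable $g:\mathbb{R}^d\times\{0,1\}\to\{0,1\}$, $\mathcal{G}$ is the set of all classifiers, $\mathcal{R}(g)=\mathbb{P}(g(X,S)\neq Y)$ (for data-dependent $g$, over a fresh independent copy, conditional on the data). $\eta(x,s)=\mathbb{P}(Y=1\mid X=x,S=s)$; $\mathbb{E}_{X\mid S=s}$ is expectation w.r.t. the conditional law of $X$ given $S=s$. The optimal fair classifier $g^*$ is a solution of $\min_{g\in\mathcal{G}}\{\mathcal{R}(g):\mathbb{P}(g(X,S)=1\mid Y=1,S=1)=\mathbb{P}(g(X,S)=1\mid Y=1,S=0)\}$, of the form $g^*(x,1)=\mathbf{1}\{1\le\eta(x,1)(2-\theta^*/\mathbb{P}(Y=1,S=1))\}$, $g^*(x,0)=\mathbf{1}\{1\le\eta(x,0)(2+\theta^*/\mathbb{P}(Y=1,S=0))\}$ with $\theta^*$ equalizing $\mathbb{E}_{X\mid S=s}[\eta(X,s)g^*(X,s)]/\mathbb{P}(Y=1\mid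 S=s)$ across $s\in\{0,1\}$. Continuity Assumption: for each $s$, $t\mapsto\mathbb{P}(\eta(X,S)\le t\mid S=s)$ is continuous on $(0,1)$, and $\mathbb{P}(\eta(X,s)\ge1/2\mid S=s)>0$. A labeled sample $\mathcal{D}_n$ of $n$ i.i.d. copies of $(X,S,Y)$ is given, and $\hat\eta:\mathbb{R}^d\times\{0,1\}\to[0,1]$ is an estimator built from $\mathcal{D}_n$. Consistency Assumption: for all $s$, (i) $\mathbb{E}_{\mathcal{D}_n}\mathbb{E}_{X\mid S=s}|\eta(X,s)-\hat\eta(X,s)|\to0$ as $n\to\infty$; (ii) there is a sequence $c_{n,N}>0$ with $c_{n,N}\to0$ and $1/(c_{n,N}\sqrt N)\to0$ such that $\mathbb{E}_{X\mid S=s}[\hat\eta(X,s)]\ge c_{n,N}$ almost surely. Estimator Continuity Assumption: almost surely, for all $s$, $t\mapsto\mathbb{P}(\hat\eta(X,s)\le t\mid S=s)$ is continuous on $(0,1)$. Pseudo-oracle: for $\theta\in\mathbb{R}$ let $\tilde g_\theta(x,1)=\mathbf{1}\{1\le\hat\eta(x,1)(2-\theta/(\mathbb{E}_{X\mid S=1}[\hat\eta(X,1)]\,\mathbb{P}(S=1)))\}$ and $\tilde g_\theta(x,0)=\mathbf{1}\{1\le\hat\eta(x,0)(2+\theta/(\mathbb{E}_{X\mid S=0}[\hat\eta(X,0)]\,\mathbb{P}(S=0)))\}$; let $\tilde\theta$ be a solution of $\frac{\mathbb{E}_{X\mid S=1}[\hat\eta(X,1)\tilde g_\theta(X,1)]}{\mathbb{E}_{X\mid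 S=1}[\hat\eta(X,1)]}=\frac{\mathbb{E}_{X\mid S=0}[\hat\eta(X,0)\tilde g_\theta(X,0)]}{\mathbb{E}_{X\mid S=0}[\hat\eta(X,0)]}$, and $\tilde g=\tilde g_{\tilde\theta}$. *)

(* Defs.v *)
From HB Require Import structures.
From mathcomp Require Import all_boot all_order all_algebra.
From mathcomp Require Import all_classical all_reals all_analysis.
Set Implicit Arguments. Unset Strict Implicit. Unset Printing Implicit Defensive.
Import Order.TTheory GRing.Theory Num.Theory.
Import numFieldNormedType.Exports.
Local Open Scope classical_set_scope.
Local Open Scope ring_scope.

Definition Rd (R : realType) (d : nat) := g_sigma_algebraType (@open 'rV[R]_d).

(* Observation space: z = ((X, S), Y) in R^d x {0,1} x {0,1}; true codes 1. *)
Definition Obs (R : realType) (d : nat) := (Rd R d * bool * bool)%type.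

Section defs.
Context {R : realType} {d : nat}.
Variable P : probability (Obs R d) R.

Definition prob (A : set (Obs R d)) : R := fine (P A).

Definition pS (s : bool) : R := prob [set z | z.1.2 = s].

Definition pYS (s : bool) : R := prob [set z | z.2 = true /\ z.1.2 = s].

Definition condE (s : bool) (f : Rd R d -> R) : R :=
  fine (\int[P]_z (f z.1.1 * (z.1.2 == s)%:R)%:E) / pS s.

Definition condP (s : bool) (A : set (Rd R d)) : R :=
  prob [set z | A z.1.1 /\ z.1.2 = s] / pS s.

Definition is_regression (eta : Rd R d -> bool -> R) : Prop :=
  [/\ forall x s, 0 <= eta x s <= 1,
      forall s, measurable_fun setT (fun x => eta x s) &
      forall (A : set (Rd R d)) (s : bool), measurable A ->
        prob [set z | A z.1.1 /\ z.1.2 = s /\ z.2 = true] =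
        fine (\int[P]_(z in [set z | A z.1.1 /\ z.1.2 = s]) (eta z.1.1 z.1.2)%:E)].

Definition classifier (g : Rd R d -> bool -> bool) : Prop :=
  forall s, measurable_fun setT (fun x => g x s).

Definition risk (g : Rd R d -> bool -> bool) : R :=
  prob [set z | g z.1.1 z.1.2 != z.2].

Definition tpr (g : Rd R d -> bool -> bool) (s : bool) : R :=
  prob [set z | g z.1.1 z.1.2 = true /\ z.2 = true /\ z.1.2 = s] / pYS s.

Definition fair (g : Rd R d -> bool -> bool) : Prop := tpr g true = tpr g false.

Definition optimal_fair (g : Rd R d -> bool -> bool) : Prop :=
  [/\ classifier g, fair g &
      forall g', classifier g' -> fair g' -> risk g <= risk g'].

Definition gstar_form (eta : Rd R d -> bool -> R) (theta : R) : Rd R d -> bool -> bool :=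
  fun x s => if s then 1 <= eta x true * (2 - theta / pYS true)
             else 1 <= eta x false * (2 + theta / pYS false).

Definition gstar_equalizing (eta : Rd R d -> bool -> R) (theta : R) : Prop :=
  condE true (fun x => eta x true * (gstar_form eta theta x true)%:R)
    / (pYS true / pS true) =
  condE false (fun x => eta x false * (gstar_form eta theta x false)%:R)
    / (pYS false / pS false).

Definition continuity_assumption (eta : Rd R d -> bool -> R) : Prop :=
  forall s, {in `]0, 1[, continuous (fun t : R => condP s [set x | eta x s <= t])}
            /\ 0 < condP s [set x | 1/2 <= eta x s].

Definition gtilde_form (etah : Rd R d -> bool -> R) (theta : R) : Rd R d -> bool -> bool :=
  fun x s => if s then
      1 <= etah x true * (2 - theta / (condE true (fun y => etah y true) * pS true))
    else
      1 <= etah x false * (2 + theta / (condE false (fun y => etah y false) * pS false)).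

Definition gtilde_equation (etah : Rd R d -> bool -> R) (theta : R) : Prop :=
  condE true (fun x => etah x true * (gtilde_form etah theta x true)%:R)
    / condE true (fun x => etah x true) =
  condE false (fun x => etah x false * (gtilde_form etah theta x false)%:R)
    / condE false (fun x => etah x false).

End defs.

(* Main.v *)
Require Import Defs.
From HB Require Import structures.
From mathcomp Require Import all_boot all_order all_algebra.
From mathcomp Require Import all_classical all_reals all_analysis.
From mathcomp Require Import measurable_realfun.
From mathcomp Require Import ring lra.
Import Order.TTheory GRing.Theory Num.Theory.
Import numFieldNormedType.Exports.
Local Open Scope classical_set_scope.
Local Open Scope ring_scope.

(** With [D_s] the unnormalised L1 distance between [eta] and its estimate on
    the group [S = s] and [a_s = P(Y = 1, S = s)], almost every data set
    satisfies
      [risk g~ - risk g* <= sum_s (2 + 4 / a_s) * D_s],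
    and the expectation of the right-hand side tends to [0].  Indeed [g~]
    minimises the estimated Lagrangian
      [g |-> sum_s E[1{S = s} g (1 - 2 eta^)] + theta (tpr^_1 g - tpr^_0 g)],
    whose constraint term vanishes at [g~].  Evaluating it at [g*] instead and
    replacing [eta^] by [eta] costs [2 D_s] in each group, while the constraint
    term of [g*], which is fair for [eta], is at most
    [|theta| sum_s 2 D_s / a_s].  Finally every solution [theta] of the
    pseudo-oracle equation satisfies [|theta| <= 2]. *)

(** * Bounded measurable functions and their integrals under a probability *)

Section bounded_measurable.
Set Implicit Arguments.
Context {R : realType} {dT : measure_display} {T : measurableType dT}.
Implicit Types f g : T -> R.

(** A class stable under ring operations and norms and integrable for every probability, so it
    discharges the side conditions of linearity and monotonicity of integrals. *)
Definition bmfun f := measurable_fun setT f /\ exists M, forall x, `|f x| <= M.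

Lemma bmfun_cst (r : R) : bmfun (fun=> r).
Proof. by split=> //; exists `|r|. Qed.

Lemma bmfunD f g : bmfun f -> bmfun g -> bmfun (fun x => f x + g x).
Proof.
move=> [mf [M fM]] [mg [N gN]]; split; first exact: measurable_funD.
by exists (M + N) => x; rewrite (le_trans (ler_normD _ _))// lerD.
Qed.

Lemma bmfunM f g : bmfun f -> bmfun g -> bmfun (fun x => f x * g x).
Proof.
move=> [mf [M fM]] [mg [N gN]]; split; first exact: measurable_funM.
by exists (M * N) => x; rewrite normrM ler_pM.
Qed.

Lemma bmfunN f : bmfun f -> bmfun (fun x => - f x).
Proof.
move=> [mf [M fM]]; split; first exact: measurableT_comp.
by exists M => x; rewrite normrN.
Qed.

Lemma bmfunB f g : bmfun f -> bmfun g -> bmfun (fun x => f x - g x).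
Proof. by move=> bf /bmfunN; exact: bmfunD. Qed.

Lemma bmfun_norm f : bmfun f -> bmfun (fun x => `|f x|).
Proof.
move=> [mf [M fM]]; split; first exact: measurableT_comp.
by exists M => x; rewrite normr_id.
Qed.

Lemma bmfun_bool (b : T -> bool) :
  measurable_fun setT b -> bmfun (fun x => (b x)%:R).
Proof.
move=> mb; split.
  exact: (measurableT_comp (f := fun b : bool => b%:R : R)).
by exists 1 => x; case: (b x); rewrite ?normr1 ?normr0.
Qed.

Lemma bmfun01 f : measurable_fun setT f -> (forall x, 0 <= f x <= 1) -> bmfun f.
Proof.
move=> mf f01; split=> //; exists 1 => x.
by case/andP: (f01 x) => f0 f1; rewrite ger0_norm.
Qed.

Lemma bmfun_integrable (P : probability T R) f :
  bmfun f -> P.-integrable setT (EFin \o f).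
Proof.
move=> [mf [M fM]]; apply: measurable_bounded_integrable => //.
  by rewrite [X in (X < _)%E]probability_setT ltry.
exists M; split; first exact: num_real.
by move=> N MN x _; exact: le_trans (fM x) (ltW MN).
Qed.

Lemma prob_Rintegral (P : probability T R) (b : T -> bool) :
  measurable_fun setT b -> fine (P [set z | b z]) = \int[P]_z (b z)%:R.
Proof.
move=> mb; rewrite /Rintegral; congr fine.
have mB : measurable [set z | b z].
  by rewrite -[X in measurable X]setTI; exact: (mb measurableT [set true]).
rewrite -[X in P X]setIT -integral_indic//.
apply: eq_integral => z _; rewrite indicE; congr (_%:R%:E).
by case: (boolP (b z)) => bz; [rewrite mem_set|rewrite memNset//; exact/negP].
Qed.
End bounded_measurable.

(** * Unnormalised expectations on a group [S = s] *)

Section weighted.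
Set Implicit Arguments.
Context {R : realType} {d : nat}.
Context (P : probability (Obs R d) R).
Implicit Types (s : bool) (f g : Rd R d -> R).

(** The conditional expectation of [f(X)] given [S = s] without its normaliser, which cancels in all
    ratios of the pseudo-oracle; contributions of the two groups then add up to plain integrals
    under [P]. *)
Definition wint s f : R := \int[P]_z (f z.1.1 * (z.1.2 == s)%:R).

Lemma condEE s f : condE P s f = wint s f / pS P s.
Proof. by []. Qed.

Lemma measurable_obsX : measurable_fun setT (fun z : Obs R d => z.1.1).
Proof. exact: (measurableT_comp (measurable_fst) measurable_fst). Qed.
Lemma measurable_obsS : measurable_fun setT (fun z : Obs R d => z.1.2).
Proof. exact: (measurableT_comp (measurable_snd) measurable_fst). Qed.
Lemma measurable_obsY : measurable_fun setT (fun z : Obs R d => z.2).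
Proof. exact: measurable_snd. Qed.
Lemma measurable_obsS_eq s : measurable_fun setT (fun z : Obs R d => z.1.2 == s).
Proof. exact: (measurableT_comp (f := fun b : bool => b == s) _ measurable_obsS). Qed.

Lemma bmfun_X f : bmfun f -> bmfun (fun z : Obs R d => f z.1.1).
Proof.
move=> [mf [M fM]]; split; first exact: measurableT_comp measurable_obsX.
by exists M.
Qed.

Lemma bmfun_wint s f : bmfun f ->
  bmfun (fun z : Obs R d => f z.1.1 * (z.1.2 == s)%:R).
Proof. by move=> bf; exact: bmfunM (bmfun_X bf) (bmfun_bool (measurable_obsS_eq s)). Qed.

Lemma wintD s f g : bmfun f -> bmfun g ->
  wint s (fun x => f x + g x) = wint s f + wint s g.
Proof.
move=> bf bg; rewrite /wint -RintegralD//; try exact/bmfun_integrable/bmfun_wint.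
by apply: eq_Rintegral => z _; rewrite mulrDl.
Qed.

Lemma wintZ s (r : R) f : bmfun f -> wint s (fun x => r * f x) = r * wint s f.
Proof.
move=> bf; rewrite /wint -RintegralZl//; last exact/bmfun_integrable/bmfun_wint.
by apply: eq_Rintegral => z _; rewrite mulrA.
Qed.

Lemma wintB s f g : bmfun f -> bmfun g ->
  wint s (fun x => f x - g x) = wint s f - wint s g.
Proof.
move=> bf bg; rewrite /wint -RintegralB//; try exact/bmfun_integrable/bmfun_wint.
by apply: eq_Rintegral => z _; rewrite mulrBl.
Qed.

Lemma le_wint s f g : bmfun f -> bmfun g -> (forall x, f x <= g x) ->
  wint s f <= wint s g.
Proof.
move=> bf bg fg; apply: le_Rintegral => //; try exact/bmfun_integrable/bmfun_wint.
by move=> z _; rewrite ler_wpM2r.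
Qed.

Lemma wint_ge0 s f : (forall x, 0 <= f x) -> 0 <= wint s f.
Proof. by move=> f0; apply: Rintegral_ge0 => z _; rewrite mulr_ge0. Qed.

Lemma eq_wint s f g : f =1 g -> wint s f = wint s g.
Proof. by move=> /funext ->. Qed.

Lemma le_norm_wint s f : bmfun f -> `|wint s f| <= wint s (fun x => `|f x|).
Proof.
move=> bf; have bnf := bmfun_norm bf.
rewrite ler_norml -mulN1r -wintZ// !le_wint// => [x||x].
- exact: ler_norm.
- by apply: bmfunM => //; exact: bmfun_cst.
- by rewrite mulN1r lerNl -normrN ler_norm.
Qed.

Lemma pSE s : pS P s = wint s (fun=> 1).
Proof.
rewrite /pS /prob /wint (_ : [set z | _] = [set z | z.1.2 == s]); last first.
  by apply/seteqP; split => z /= /eqP.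
rewrite prob_Rintegral; last exact: measurable_obsS_eq.
by apply: eq_Rintegral => z _; rewrite mul1r.
Qed.

Lemma pS_addN : pS P true + pS P false = 1.
Proof.
have i1 s := bmfun_integrable P (bmfun_wint s (bmfun_cst 1)).
rewrite !pSE /wint -RintegralD//; try exact: i1.
under eq_Rintegral => z _.
  rewrite (_ : _ + _ = cst 1 z); last by case: z.1.2 => /=; ring.
  over.
by rewrite /Rintegral /= integral_cst// mul1e [X in fine X]probability_setT.
Qed.

Lemma pS_le1 s : pS P s <= 1.
Proof.
have p0 s' : 0 <= pS P s' by rewrite pSE; apply: wint_ge0.
by rewrite -pS_addN; case: s; rewrite ?lerDl ?lerDr p0.
Qed.

(** * Risk and true positive rates in terms of the regression function *)

Context (eta : Rd R d -> bool -> R) (reg : is_regression P eta).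

Lemma bmfun_eta s : bmfun (fun x => eta x s).
Proof. by have [e01 me _] := reg; exact: bmfun01. Qed.

Lemma bmfun_classifier (g : Rd R d -> bool -> bool) s : classifier g ->
  bmfun (fun x => (g x s)%:R : R).
Proof. by move=> cg; exact: bmfun_bool. Qed.

Lemma prob_regression (a : Rd R d -> bool) s : measurable_fun setT a ->
  prob P [set z | a z.1.1 /\ z.1.2 = s /\ z.2 = true] =
  wint s (fun x => eta x s * (a x)%:R).
Proof.
move=> ma; have [_ _ /(_ [set x | a x] s) ->] := reg; last first.
  by rewrite -[X in measurable X]setTI; exact: (ma measurableT [set true]).
rewrite integral_mkcond; congr fine; apply: eq_integral => z _.
rewrite patchE; case: ifPn => [|/negP]; rewrite inE/=.
  by move=> [-> ->]; rewrite eqxx !mulr1.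
move=> nA; case: (boolP (a z.1.1)) => az; last by rewrite mulr0 mul0r.
case: eqP => [zs|_]; last by rewrite mulr0.
by exfalso; apply: nA.
Qed.

Lemma pYSE s : pYS P s = wint s (fun x => eta x s).
Proof.
have := prob_regression s (measurable_cst true).
rewrite (_ : [set z | _] = [set z | z.2 = true /\ z.1.2 = s]).
  by rewrite /pYS => ->; apply: eq_wint => x; rewrite mulr1.
by apply/seteqP; split => z /= => [[_ []]|[]].
Qed.

Lemma tprE (g : Rd R d -> bool -> bool) s : classifier g ->
  tpr P g s = wint s (fun x => eta x s * (g x s)%:R) / wint s (fun x => eta x s).
Proof.
move=> cg; rewrite /tpr -pYSE -(prob_regression s (cg s)); congr (prob P _ / _).
by apply/seteqP; split => z /= [] => [gz [? zs]|gz [zs ?]]; move: gz; rewrite zs.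
Qed.

(** Pointwise [1{g <> Y} = Y + g (1 - 2 Y)], and averaging over [Y] given [(X, S)] turns [Y] into
    [eta]. *)
Lemma riskE (g : Rd R d -> bool -> bool) : classifier g ->
  risk P g = prob P [set z | z.2 = true] +
  (wint true (fun x => (g x true)%:R * (1 - 2 * eta x true)) +
   wint false (fun x => (g x false)%:R * (1 - 2 * eta x false))).
Proof.
move=> cg.
have bg s : bmfun (fun x => (g x s)%:R : R) by exact: bmfun_classifier.
have be := bmfun_eta.
(* Trading [eta] back for the label [Y] reduces the claim to an identity between integrands, checked
   by cases at the end. *)
have E s : wint s (fun x => (g x s)%:R * (1 - 2 * eta x s)) =
    wint s (fun x => (g x s)%:R) -
    2 * prob P [set z | g z.1.1 s /\ z.1.2 = s /\ z.2 = true].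
  rewrite (prob_regression s (cg s)) -wintZ; last exact: bmfunM.
  rewrite -wintB//; last by apply: bmfunM; [exact: bmfun_cst|exact: bmfunM].
  by apply: eq_wint => x; ring.
have mgX s : measurable_fun setT (fun z : Obs R d => g z.1.1 s).
  exact: measurableT_comp (cg s) measurable_obsX.
have mI s : measurable_fun setT (fun z : Obs R d => [&& g z.1.1 s, z.1.2 == s & z.2]).
  apply: measurable_and => //.
  by apply: measurable_and; [exact: measurable_obsS_eq|exact: measurable_obsY].
have EI s : prob P [set z | g z.1.1 s /\ z.1.2 = s /\ z.2 = true] =
    \int[P]_z ([&& g z.1.1 s, z.1.2 == s & z.2])%:R.
  rewrite -prob_Rintegral//; congr (prob P _).
  apply/seteqP; split => z /=; first by move=> [-> [-> ->]]; rewrite eqxx.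
  by case/and3P => ? /eqP ? ?.
(* [classifier] gives measurability of each slice of [g] only, hence the disjunction over the values
   of [S]. *)
have mg : measurable_fun setT (fun z : Obs R d => g z.1.1 z.1.2).
  rewrite (_ : (fun _ => _) = fun z : Obs R d =>
      (g z.1.1 true && (z.1.2 == true)) || (g z.1.1 false && (z.1.2 == false))).
    by apply: measurable_or; apply: measurable_and => //; exact: measurable_obsS_eq.
  by apply/funext => z; case: z.1.2; rewrite /= ?andbT ?andbF ?orbF.
have mN : measurable_fun setT (fun z : Obs R d => g z.1.1 z.1.2 != z.2).
  rewrite (_ : (fun _ => _) = fun z : Obs R d =>
      (g z.1.1 z.1.2 && ~~ z.2) || (~~ g z.1.1 z.1.2 && z.2)).
    have mY := measurable_obsY.
    by apply: measurable_or; apply: measurable_and => //; exact: measurable_neg.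
  by apply/funext => z; case: (g _ _) (z.2) => [] [].
rewrite !E !EI /risk {1}/prob prob_Rintegral//.
have -> : prob P [set z | z.2 = true] = \int[P]_z (z.2)%:R.
  by rewrite -prob_Rintegral//; exact: measurable_obsY.
have bY : bmfun (fun z : Obs R d => (z.2)%:R : R).
  exact: bmfun_bool (measurable_obsY).
have bI s := bmfun_bool (R := R) (mI s).
have bW s := bmfun_wint s (bg s).
have b2I s : bmfun (fun z => 2 * ([&& g z.1.1 s, z.1.2 == s & z.2])%:R : R).
  by apply: bmfunM => //; exact: bmfun_cst.
have bD s := bmfunB (bW s) (b2I s).
have ib (f : Obs R d -> R) (bf : bmfun f) := bmfun_integrable P bf.
rewrite /wint -!RintegralZl//; try exact: ib.
rewrite -!RintegralB//; try exact: ib.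
rewrite -!RintegralD//; try exact: ib; try exact: (ib _ (bmfunD (bD true) (bD false))).
apply: eq_Rintegral => -[[x s] y] _ /=.
by case: s y => [] []; case: (g x true); case: (g x false) => /=; ring.
Qed.

End weighted.

(** * Regret of the pseudo-oracle for one fixed data set *)

Section regret.
Set Implicit Arguments.
Context {R : realType} {d : nat}.
Context (P : probability (Obs R d) R).

Lemma bmfun_threshold (h : Rd R d -> R) (c : R) : bmfun h ->
  bmfun (fun x => (1 <= h x * c)%R%:R : R).
Proof.
move=> [mh _]; apply: bmfun_bool; apply: measurable_fun_ler => //.
by apply: measurable_funM.
Qed.

(* If [theta > 2 >= 2 A], group [s] is never accepted, so the equation forces
   [h'] to stay below the threshold of group [s'] almost surely; integrating
   this bound gives [2 A' + theta <= P(S = s') <= 1]. *)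
Lemma threshold_le2 s s' (h h' : Rd R d -> R) (theta : R) :
  bmfun h -> bmfun h' -> (forall x, 0 <= h x <= 1) -> (forall x, 0 <= h' x <= 1) ->
  0 < wint P s h -> 0 < wint P s' h' ->
  wint P s (fun x => h x * (1 <= h x * (2 - theta / wint P s h))%R%:R) / wint P s h =
  wint P s' (fun x => h' x * (1 <= h' x * (2 + theta / wint P s' h'))%R%:R)
    / wint P s' h' ->
  theta <= 2.
Proof.
move=> bh bh' h01 h'01; set A := wint P s h; set A' := wint P s' h' => A0 A'0 e.
rewrite leNgt; apply/negP => th2.
have A1 : A <= 1.
  rewrite (le_trans _ (pS_le1 P s))// pSE; apply: le_wint => //.
    exact: bmfun_cst.
  by move=> x; case/andP: (h01 x).
have c0 : 2 - theta / A < 0 by rewrite subr_lt0 ltr_pdivlMr//; nra.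
have L0 : wint P s (fun x => h x * (1 <= h x * (2 - theta / A))%R%:R) = 0.
  rewrite -[RHS](mul0r (wint P s (fun=> 1))) -wintZ; last exact: bmfun_cst.
  apply: eq_wint => x; rewrite mul0r; case: leP => //; last by rewrite mulr0.
  by case/andP: (h01 x) => ? ? ?; nra.
move: e; rewrite L0 mul0r => /esym/eqP.
rewrite mulf_eq0 invr_eq0 (gt_eqF A'0) orbF => /eqP W0.
set c := 2 + theta / A' in W0.
have c'0 : 0 < c by rewrite addr_gt0// divr_gt0//; lra.
have bW : bmfun (fun x => h' x * (1 <= h' x * c)%R%:R).
  by apply: bmfunM => //; exact: bmfun_threshold.
(* The indicator term makes the bound hold at every [x] and integrates to [0] by [W0], so no almost
   everywhere argument is involved. *)
have : wint P s' (fun x => c * h' x) <=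
    wint P s' (fun x => 1 + c * (h' x * (1 <= h' x * c)%R%:R)).
  apply: le_wint.
  - by apply: bmfunM => //; exact: bmfun_cst.
  - by apply: bmfunD; [exact: bmfun_cst|apply: bmfunM => //; exact: bmfun_cst].
  - move=> x; rewrite mulrA (mulrC c); move: (h' x * c) => u.
    by case: (leP 1 u) => u1 /=; rewrite ?mulr1 ?mulr0; lra.
rewrite wintD ?wintZ//; [|exact: bmfun_cst|by apply: bmfunM => //; exact: bmfun_cst].
rewrite W0 mulr0 addr0 -pSE -/A' /c mulrDl divfK ?gt_eqF// => le1.
by have := pS_le1 P s'; lra.
Qed.

(** With [e] the true regression function and [h] its estimate, this turns exact fairness of [g]
    into approximate fairness for the estimate. *)
Lemma wint_ratio_dist_le s (e h g : Rd R d -> R) :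
  bmfun e -> bmfun h -> bmfun g -> (forall x, 0 <= h x) -> (forall x, 0 <= g x <= 1) ->
  0 < wint P s e -> 0 < wint P s h ->
  `|wint P s (fun x => h x * g x) / wint P s h -
    wint P s (fun x => e x * g x) / wint P s e| <=
  2 / wint P s e * wint P s (fun x => `|e x - h x|).
Proof.
move=> be bh bg h0 g01; set a := wint P s e; set A := wint P s h => a0 A0.
set W := wint P s (fun x => h x * g x); set E := wint P s (fun x => e x * g x).
set D := wint P s _.
have bd := bmfun_norm (bmfunB be bh).
have W0 : 0 <= W.
  by apply: wint_ge0 => x; case/andP: (g01 x) => ? ?; rewrite mulr_ge0.
have WA : W <= A.
  apply: le_wint => //; first exact: bmfunM.
  by move=> x; case/andP: (g01 x) => ? ?; rewrite ler_piMr.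
have aA : `|a - A| <= D.
  by rewrite -wintB//; apply: le_norm_wint; exact: bmfunB.
have WE : `|E - W| <= D.
  rewrite -wintB; try exact: bmfunM.
  apply: le_trans (le_norm_wint _ _ _) _; first by apply: bmfunB; exact: bmfunM.
  apply: le_wint => //; first by apply: bmfun_norm; apply: bmfunB; exact: bmfunM.
  move=> x; case/andP: (g01 x) => ? ?.
  by rewrite -mulrBl normrM ler_piMr// ger0_norm.
(* Only [a] is kept as a denominator: the difference is [(r (a - A) + (W - E)) / a] with [r] in
   [[0, 1]], and both differences are at most [D]. *)
pose r := W / A.
have r0 : 0 <= r by rewrite divr_ge0// ltW.
have r1 : r <= 1 by rewrite ler_pdivrMr// mul1r.
have Wr : W = r * A by rewrite divfK// gt_eqF.
rewrite -/r (_ : r - E / a = (r * (a - A) + (W - E)) / a); last first.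
  by rewrite Wr; field; rewrite gt_eqF.
rewrite normrM normfV (gtr0_norm a0) [leRHS]mulrAC ler_pM2r ?invr_gt0//.
apply: le_trans (ler_normD _ _) _.
rewrite mulr2n mulrDl !mul1r lerD ?(distrC W)// normrM (ger0_norm r0).
by rewrite (le_trans _ aA)// ler_piMl.
Qed.

(** The integrands are [gt] and [g] times the common factor [1 - h (2 - k)], and [gt] is [1] exactly
    where this factor is nonpositive. *)
Lemma threshold_minimizes s (h g gt : Rd R d -> R) (k : R) :
  gt = (fun x => (1 <= h x * (2 - k))%R%:R) -> bmfun h -> bmfun g ->
  (forall x, 0 <= g x <= 1) ->
  wint P s (fun x => gt x * (1 - 2 * h x)) + k * wint P s (fun x => h x * gt x) <=
  wint P s (fun x => g x * (1 - 2 * h x)) + k * wint P s (fun x => h x * g x).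
Proof.
move=> gtE bh bg g01; have bgt : bmfun gt by rewrite gtE; exact: bmfun_threshold.
have b12 : bmfun (fun x => 1 - 2 * h x).
  apply: bmfunB; first exact: bmfun_cst.
  by apply: bmfunM => //; exact: bmfun_cst.
have bk f : bmfun f -> bmfun (fun x => k * f x) by apply: bmfunM; exact: bmfun_cst.
have [bh1 bh2] := (bmfunM bgt b12, bmfunM bg b12).
have [bh3 bh4] := (bmfunM bh bgt, bmfunM bh bg).
rewrite -!wintZ// -!wintD//; [|exact: bk..].
apply: le_wint; try by apply: bmfunD => //; exact: bk.
by move=> x; case/andP: (g01 x); rewrite gtE; case: (leP 1 (h x * _)) => /= ? ? ?; nra.
Qed.

(** Replacing [e] by [h] changes the integrand by [2 (f - g) (h - e)], where [|f - g| <= 1]. *)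
Lemma wint_perturbation_le s (e h f g : Rd R d -> R) :
  bmfun e -> bmfun h -> bmfun f -> bmfun g ->
  (forall x, 0 <= f x <= 1) -> (forall x, 0 <= g x <= 1) ->
  wint P s (fun x => f x * (1 - 2 * e x)) - wint P s (fun x => g x * (1 - 2 * e x)) <=
  wint P s (fun x => f x * (1 - 2 * h x)) - wint P s (fun x => g x * (1 - 2 * h x)) +
  2 * wint P s (fun x => `|e x - h x|).
Proof.
move=> be bh bf bg f01 g01.
have b12 u : bmfun u -> bmfun (fun x : Rd R d => 1 - 2 * u x : R).
  move=> bu; apply: bmfunB; first exact: bmfun_cst.
  by apply: bmfunM => //; exact: bmfun_cst.
have [bfe bge] := (bmfunM bf (b12 _ be), bmfunM bg (b12 _ be)).
have [bfh bgh] := (bmfunM bf (b12 _ bh), bmfunM bg (b12 _ bh)).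
have bd := bmfun_norm (bmfunB be bh).
have b2d := bmfunM (bmfun_cst 2) bd.
have bfgh := bmfunB bfh bgh.
rewrite -!wintB// -wintZ// -wintD//; apply: le_wint => //.
- exact: bmfunB.
- exact: bmfunD.
move=> x; case/andP: (f01 x) => ? ?; case/andP: (g01 x) => ? ?.
have [n1 n2] : e x - h x <= `|e x - h x| /\ h x - e x <= `|e x - h x|.
  by split; [|rewrite distrC]; exact: ler_norm.
by nra.
Qed.

Context (eta h : Rd R d -> bool -> R).
Context (reg : is_regression P eta).
Context (eta_pos : forall s, 0 < wint P s (fun x => eta x s)).
Context (bh : forall s, bmfun (fun x => h x s)).
Context (h01 : forall x s, 0 <= h x s <= 1).
Context (p_pos : forall s, 0 < pS P s).
Context (h_pos : forall s, 0 < wint P s (fun x => h x s)).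

Lemma gtilde_formE theta : gtilde_form P h theta = fun x s =>
  if s then 1 <= h x true * (2 - theta / wint P true (fun x => h x true))
  else 1 <= h x false * (2 + theta / wint P false (fun x => h x false)).
Proof.
apply/funext => x; apply/funext => s.
by rewrite /gtilde_form !condEE !divfK// gt_eqF.
Qed.

Lemma classifier_gtilde theta : classifier (gtilde_form P h theta).
Proof.
by case; rewrite gtilde_formE; apply: measurable_fun_ler => //;
  apply: measurable_funM => //; case: (bh true); case: (bh false).
Qed.

(** The [2] is the cost of exchanging [eta] and [h] in the risks; the [4] is the bound [2] on
    [|theta|] times the factor [2] of [wint_ratio_dist_le]. *)
Lemma gtilde_regret theta g : classifier g -> fair P g ->
  gtilde_equation P h theta ->
  risk P (gtilde_form P h theta) - risk P g <=
  (2 + 4 / wint P true (fun x => eta x true)) *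
    wint P true (fun x => `|eta x true - h x true|) +
  (2 + 4 / wint P false (fun x => eta x false)) *
    wint P false (fun x => `|eta x false - h x false|).
Proof.
move=> cg fg eqn.
have cgt := classifier_gtilde theta.
rewrite !(riskE reg)//.
move: fg; rewrite /fair !(tprE reg)// => fg.
have be s : bmfun (fun x => eta x s) by exact: bmfun_eta reg s.
have [e01 _ _] := reg.
have g01 (f : Rd R d -> bool -> bool) s x : 0 <= ((f x s)%:R : R) <= 1.
  by rewrite ler0n lern1 leq_b1.
have bg s := bmfun_classifier (R := R) s cg.
have bgt s := bmfun_classifier (R := R) s cgt.
have h0 s x : 0 <= h x s by case/andP: (h01 x s).
have pt s := wint_perturbation_le s (be s) (bh s) (bgt s) (bg s)
  (g01 (gtilde_form P h theta) s) (g01 g s).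
have close s := wint_ratio_dist_le s (be s) (bh s) (bg s) (h0 s) (g01 g s)
  (eta_pos s) (h_pos s).
have {}eqn :
    wint P true (fun x => h x true * (gtilde_form P h theta x true)%:R)
      / wint P true (fun x => h x true) =
    wint P false (fun x => h x false * (gtilde_form P h theta x false)%:R)
      / wint P false (fun x => h x false).
  move: eqn; rewrite /gtilde_equation !condEE.
  have pdiv s (u v : R) : u / pS P s / (v / pS P s) = u / v.
    by rewrite invf_div mulrA divfK// gt_eqF.
  by rewrite !pdiv.
have th2 : `|theta| <= 2.
  rewrite ler_norml lerNl; apply/andP; split.
    (* Exchanging the two groups negates [theta], which yields the lower bound. *)
    apply: (threshold_le2 false true (- theta) (bh false) (bh true)
      (h01^~ false) (h01^~ true) (h_pos false) (h_pos true)).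
    by move: (esym eqn); rewrite gtilde_formE !mulNr opprK.
  apply: (threshold_le2 true false theta (bh true) (bh false) (h01^~ true) (h01^~ false)
    (h_pos true) (h_pos false)).
  by move: eqn; rewrite gtilde_formE.
(* The estimated Lagrangian splits by group, the multiplier entering with opposite signs. *)
have lt := threshold_minimizes true (theta / wint P true (fun x => h x true))
  (gt := fun x => (gtilde_form P h theta x true)%:R)
  ltac:(by rewrite gtilde_formE) (bh true) (bg true) (g01 g true).
have lf := threshold_minimizes false (- (theta / wint P false (fun x => h x false)))
  (gt := fun x => (gtilde_form P h theta x false)%:R)
  ltac:(by rewrite gtilde_formE opprK) (bh false) (bg false) (g01 g false).
have mdivA a b : theta / a * b = theta * (b / a) by rewrite mulrAC mulrA.
(* After rewriting with [eqn], the constraint terms of the pseudo-oracle in [lt] and [lf] are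
   opposite and cancel in the sum. *)
move: lt lf; rewrite mulNr mulNr !mdivA eqn => lt lf.
(* By fairness both estimated rates of [g] are close to one common true rate, the middle point of
   the triangle inequality below. *)
have := (pt true, pt false, close true, close false); rewrite fg.
move=> [[[ptt ptf] ct] cf].
have {ct cf} : `|theta * (wint P true (fun x => h x true * (g x true)%:R)
    / wint P true (fun x => h x true) -
    wint P false (fun x => h x false * (g x false)%:R)
    / wint P false (fun x => h x false))| <= 2 *
    (2 / wint P true (fun x => eta x true) *
       wint P true (fun x => `|eta x true - h x true|) +
     2 / wint P false (fun x => eta x false) *
       wint P false (fun x => `|eta x false - h x false|)).
  rewrite normrM ler_pM//.
  by apply: le_trans (ler_distD _ _ _) (lerD ct _); rewrite distrC.
by move=> /(le_trans (ler_norm _)); lra.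
Qed.
End regret.

(** * Integration over the data and passage to the limit *)

Section asymptotics.
Set Implicit Arguments.

Lemma prob_X_S (R : realType) (d : nat) (P : probability (Obs R d) R)
    (a : Rd R d -> bool) (s : bool) : measurable_fun setT a ->
  prob P [set z | a z.1.1 /\ z.1.2 = s] = wint P s (fun x => (a x)%:R).
Proof.
move=> ma; rewrite /prob (_ : [set z | _] = [set z | a z.1.1 && (z.1.2 == s)]).
  rewrite prob_Rintegral; last first.
    apply: measurable_and; last exact: measurable_obsS_eq.
    exact: measurableT_comp ma measurable_obsX.
  by apply: eq_Rintegral => z _; case: (a _) (_ == _) => [] [] /=; ring.
by apply/seteqP; split => z /=; [move=> [-> ->]; rewrite eqxx|case/andP => ? /eqP].
Qed.

(** [eta] dominates half the indicator of [1/2 <= eta], an event of positive probability in each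
    group by [continuity_assumption]. *)
Lemma wint_eta_gt0 (R : realType) (d : nat) (P : probability (Obs R d) R)
    (eta : Rd R d -> bool -> R) (s : bool) :
  is_regression P eta -> continuity_assumption P eta -> 0 < pS P s ->
  0 < wint P s (fun x => eta x s).
Proof.
move=> reg /(_ s)[_] + ps; have be := bmfun_eta reg s; have [e01 me _] := reg.
have mc : measurable_fun setT (fun x : Rd R d => 1 / 2 <= eta x s).
  exact: measurable_fun_ler.
rewrite /condP (prob_X_S P s mc) pmulr_lgt0 ?invr_gt0// => w0.
have bc := bmfun_bool (R := R) mc.
suff : 1 / 2 * wint P s (fun x => (1 / 2 <= eta x s)%R%:R) <= wint P s (fun x => eta x s).
  by apply: lt_le_trans; rewrite mulr_gt0.
rewrite -wintZ//; apply: le_wint => //.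
  by apply: bmfunM => //; exact: bmfun_cst.
move=> x; case: (leP (1 / 2) (eta x s)) => /= [|_]; first by rewrite mulr1.
by rewrite mulr0; case/andP: (e01 x s).
Qed.

Lemma le_limn_esup (R : realType) (u v : (\bar R)^nat) :
  (forall n, (u n <= v n)%E) -> (limn_esup u <= limn_esup v)%E.
Proof.
move=> uv; rewrite !limn_esup_lim; apply: lee_lim.
- exact: is_cvg_esups.
- exact: is_cvg_esups.
apply: nearW => n; apply: ge_ereal_sup => _ [m nm <-].
by apply: le_trans (uv m) _; apply: ereal_sup_ubound; exists m.
Qed.

(** Tonelli, once [f] is pulled back from pairs (data, point) to pairs (data, observation). *)
Lemma measurable_condE (R : realType) (d : nat) (P : probability (Obs R d) R)
    (dO : measure_display) (Omega : measurableType dO) (s : bool)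
    (f : Omega -> Rd R d -> R) :
  (forall w x, 0 <= f w x) ->
  measurable_fun setT (fun p : Omega * Rd R d => f p.1 p.2) ->
  measurable_fun setT (fun w => condE P s (f w)).
Proof.
move=> f0 mf; apply: measurable_funM => //.
apply: (measurableT_comp (fine_measurable _)) => //=.
apply: (measurable_fun_fubini_tonelli_F (m2 := P)
  (fun p : Omega * Obs R d => (f p.1 p.2.1.1 * (p.2.1.2 == s)%:R)%:E)); last first.
  by move=> p; rewrite lee_fin mulr_ge0.
apply/measurable_EFinP; apply: measurable_funM.
  apply: (measurableT_comp (f := fun p : Omega * Rd R d => f p.1 p.2)
    (g := fun p : Omega * Obs R d => (p.1, p.2.1.1)) mf).
  apply: measurable_fun_pair => //.
  exact: measurableT_comp measurable_obsX measurable_snd.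
apply: (measurableT_comp (f := fun b : bool => b%:R : R)) => //.
exact: measurableT_comp (measurable_obsS_eq s) measurable_snd.
Qed.

End asymptotics.

Theorem mainTheorem7 (R : realType) (d : nat)
  (P : probability (Obs R d) R)
  (eta : Rd R d -> bool -> R)
  (theta_star : R)
  (dO : nat -> measure_display) (Omega : forall n : nat, measurableType (dO n))
  (PD : forall n : nat, probability (Omega n) R)
  (etah : forall n : nat, Omega n -> Rd R d -> bool -> R)
  (theta_tilde : forall n : nat, Omega n -> R) :
  (* the law P *)
  0 < pS P true < 1 ->
  0 < prob P [set z | z.2 = true] < 1 ->
  is_regression P eta ->
  (* Continuity Assumption *)
  continuity_assumption P eta ->
  (* the optimal fair classifier g* *)
  gstar_equalizing P eta theta_star ->
  optimal_fair P (gstar_form P eta theta_star) ->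
  (* the estimators: [0,1]-valued, jointly measurable in (data, x) *)
  (forall n w x s, 0 <= etah n w x s <= 1) ->
  (forall n s, measurable_fun setT (fun p : Omega n * Rd R d => etah n p.1 p.2 s)) ->
  (* Consistency Assumption (i) *)
  (forall s, (fun n => (\int[PD n]_w
                (condE P s (fun x => `|eta x s - etah n w x s|))%:E)%E) @ \oo --> 0%E) ->
  (* Consistency Assumption (ii) *)
  (exists (N : nat -> nat) (c : nat -> R),
      [/\ forall n, 0 < c n,
          c @ \oo --> 0,
          (fun n => (c n * Num.sqrt (N n)%:R)^-1) @ \oo --> 0 &
          forall n, {ae PD n, forall w, forall s,
                       c n <= condE P s (fun x => etah n w x s)}]) ->
  (* Estimator Continuity Assumption *)
  (forall n, {ae PD n, forall w, forall s,
      {in `]0, 1[, continuous (fun t : R => condP P s [set x | etah n w x s <= t])}}) ->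
  (* theta_tilde solves the pseudo-oracle equation (for almost every data set) *)
  (forall n, {ae PD n, forall w, gtilde_equation P (etah n w) (theta_tilde n w)}) ->
  (* E_{D_n}[R(g~)] is well defined *)
  (forall n, measurable_fun setT
     (fun w => risk P (gtilde_form P (etah n w) (theta_tilde n w)))) ->
  (limn_esup (fun n =>
      (\int[PD n]_w (risk P (gtilde_form P (etah n w) (theta_tilde n w)))%:E
       - (risk P (gstar_form P eta theta_star))%:E)%E) <= 0)%E.
Proof.
move=> pS01 _ reg ca _ [cg fg _] h01 mh cons1 [_ [c [c0 _ _ cle]]] _ eqn mrisk.
have p_pos s : 0 < pS P s.
  have := pS_addN P; case/andP: pS01 => p0 p1.
  by case: s => //; move=> ?; lra.
have eta_pos s : 0 < wint P s (fun x => eta x s) by exact: wint_eta_gt0.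
have [e01 me _] := reg.
have mhw n w s : measurable_fun setT (fun x => etah n w x s).
  exact: (measurable_fun_pair2 w (mh n s)).
have bh n w s : bmfun (fun x => etah n w x s) by exact: bmfun01.
pose D n s w := condE P s (fun x => `|eta x s - etah n w x s|).
(* [D] is normalised while [gtilde_regret] uses [wint], hence the factor [pS P s]; [K] does not
   depend on [n]. *)
pose K s := (2 + 4 / wint P s (fun x => eta x s)) * pS P s.
have K0 s : 0 <= K s.
  by rewrite mulr_ge0 ?(ltW (p_pos s))// addr_ge0// divr_ge0// ltW.
have D0 n s w : 0 <= D n s w.
  by rewrite /D condEE divr_ge0 ?(ltW (p_pos s))//; exact: wint_ge0.
have mD n s : measurable_fun setT (D n s).
  apply: measurable_condE => //.
  apply: measurableT_comp => //; apply: measurable_funB => //.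
  exact: measurableT_comp (me s) measurable_snd.
set r := risk P (gstar_form P eta theta_star).
have r0 : 0 <= r by rewrite fine_ge0.
have regret n : {ae PD n, forall w,
    risk P (gtilde_form P (etah n w) (theta_tilde n w)) <=
    r + (K true * D n true w + K false * D n false w)}.
  apply: filterS2 (cle n) (eqn n) => w cw ew.
  (* The lower bound [c n > 0] keeps the denominators of the pseudo-oracle positive for almost every
     data set. *)
  have h_pos s : 0 < wint P s (fun x => etah n w x s).
    have := lt_le_trans (c0 n) (cw s).
    by rewrite condEE pmulr_lgt0// invr_gt0.
  have := gtilde_regret reg eta_pos (bh n w) (h01 n w) p_pos h_pos cg fg ew.
  rewrite -/r lerBlDl => /le_trans; apply.
  by rewrite /K /D !condEE -!mulrA !(mulrC (pS P _)) !divfK// gt_eqF.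
pose I n s := (\int[PD n]_w (D n s w)%:E)%E.
have bound n : (\int[PD n]_w (risk P (gtilde_form P (etah n w) (theta_tilde n w)))%:E - r%:E
    <= (K true)%:E * I n true + (K false)%:E * I n false)%E.
  (* With [r] on the right both integrands are nonnegative, so comparison and additivity hold in the
     extended reals; [r] enters the integral because [PD n] has mass one. *)
  rewrite leeBlDl//.
  apply: (@le_trans _ _ (\int[PD n]_w (r%:E + ((K true)%:E * (D n true w)%:E +
      (K false)%:E * (D n false w)%:E)))%E).
    apply: ae_ge0_le_integral => //.
    - by move=> w _; rewrite lee_fin fine_ge0.
    - exact/measurable_EFinP.
    - by move=> w _; rewrite -!EFinM -!EFinD lee_fin !addr_ge0// mulr_ge0.
    - under eq_fun do rewrite -!EFinM -!EFinD.
      apply/measurable_EFinP; apply: measurable_funD => //.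
      by apply: measurable_funD; apply: measurable_funM.
    - apply: filterS (regret n) => w rw _.
      by rewrite -!EFinM -!EFinD lee_fin.
  have mKD s : measurable_fun setT (fun w => ((K s)%:E * (D n s w)%:E)%E).
    by under eq_fun do rewrite -EFinM; apply/measurable_EFinP; apply: measurable_funM.
  have KD0 s w : (0 <= (K s)%:E * (D n s w)%:E)%E by rewrite mule_ge0// lee_fin.
  rewrite ge0_integralD//; last 2 first.
  - by move=> w _; rewrite adde_ge0.
  - exact: emeasurable_funD.
  rewrite ge0_integralD// !ge0_integralZl//; try exact/measurable_EFinP;
    try (by rewrite lee_fin); try by move=> w _; rewrite lee_fin.
  by rewrite integral_cst// [X in (_ * X)%E]probability_setT mule1.
have lle := le_limn_esup _ _ _ bound.
apply: le_trans lle _.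
have IK s : (fun n => ((K s)%:E * I n s)%E) @ \oo --> 0%E.
  by rewrite -(mule0 (K s)%:E); apply: cvgeZl => //; exact: cons1.
have cv : (fun n => ((K true)%:E * I n true + (K false)%:E * I n false)%E) @ \oo --> 0%E.
  by rewrite -[X in _ --> X](adde0 0%E); apply: cvgeD.
by rewrite (cvg_limn_einf_sup cv).2.
Qed.
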